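(* Let $P$ be a rooted forest. An interval $[u,w]$ in $P^*$ contains a non-trivial disconnected subinterval if and only if there exist an embedding $\eta$ of $u$ in $w$, an element $a\in P_0$ of rank at least $3$, and positions $i<j$, that satisfy all of the following conditions: - $w(i)\ge_0 a\ge_0 \eta(i)$; - $w(j)\ge_0 a$; - $\eta(i+1),\ldots,\eta(j)$ are all zero.
   Context: A rooted forest is a poset $P$ that is a disjoint union of trees, each rooted at a unique bottom element; equivalently, letting $P_0$ denote $P$ with a bottom element $0$ adjoined, every element of $P_0$ except $0$ covers exactly one element (each element $x$ of $P_0$ has finite rank, the length of the chain from $0$ to $x$). The order on $P_0$ is written $\le_0$. $P^*$ is the set of finite words over the alphabet $P$, with generalized subword order: $u\le w$ if there is a subword $w(i_1)\cdots w(i_k)$ ($i_1<\dots<i_k$) of the same length as $u$ with $u(j)\le_P w(i_j)$ for all $1\le j\le k$. $\ell(w)$ is the number of letters of $w$, and $|w|$ is the sum of the ranks of its letters in $P_0$ (the rank of $w$ in $P^*$). An embedding of $u$ in $w$ is a word $\eta$ over $P_0$ obtained from $u$ by inserting $\ell(w)-\ell(u)$ zeros such that $\eta(i)\le_0 w(i)$ for $1\le i\le\ell(w)$. $[u,w]=\{v:u\le v\le w\}$ and $(u,w)=\{v:u<v<w\}$; a subinterval of $[u,w]$ is $[u',w']$ with $u\le u'\le w'\le w$, of rank $|w'|-|u'|$. An interval $[u',w']$ is disconnected if the order complex of the open interval $(u',w')$ is disconnected, i.e. $(u',w')$ is the disjoint union of two nonempty subsets with no element of one comparable to an element of the other. A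 disconnected subinterval is non-trivial if it has rank at least $3$. *)

(* Defs.v *)
From HB Require Import structures.
From mathcomp Require Import all_boot all_order.
From mathcomp Require Import boolp classical_sets.

Set Implicit Arguments.
Unset Strict Implicit.
Unset Printing Implicit Defensive.

Import Order.TTheory.

Local Open Scope classical_set_scope.
Local Open Scope order_scope.

(* [adjoin0 T] is P_0: the poset P = T with a new bottom element [None]
   adjoined, which is written [\bot] below. *)
Definition adjoin0 (T : Type) : Type := option T.

Definition inj0 (T : Type) (x : T) : adjoin0 T := Some x.

HB.instance Definition _ (T : choiceType) := Choice.copy (adjoin0 T) (option T).

Section Adjoin0Order.
Context {disp : Order.disp_t} {T : porderType disp}.

Definition le0 (x y : adjoin0 T) : bool :=
  match x, y with
  | None, _ => true
  | Some _, None => false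
  | Some a, Some b => a <= b
  end.

Lemma le0_refl : reflexive le0.
Proof. by case=> /=. Qed.

Lemma le0_anti : antisymmetric le0.
Proof. by move=> [a|] [b|] //= /le_anti ->. Qed.

Lemma le0_trans : transitive le0.
Proof. by move=> [b|] [a|] [c|] //=; apply: le_trans. Qed.

HB.instance Definition _ :=
  Order.Le_isPOrder.Build disp (adjoin0 T) le0_refl le0_anti le0_trans.

Lemma le0_bot (x : adjoin0 T) : (None : adjoin0 T) <= x.
Proof. by []. Qed.

HB.instance Definition _ := Order.hasBottom.Build disp (adjoin0 T) le0_bot.

End Adjoin0Order.

Section RootedForest.
Context {disp : Order.disp_t} (T : porderType disp).

Definition covered_by (x y : adjoin0 T) : Prop :=
  x < y /\ forall z : adjoin0 T, ~ (x < z < y).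

(* [\bot :: s] is the whole interval [0, x] of P_0, and it is a chain;
   its length is the number of steps, that is [size s]. *)
Definition is_chain_to (x : adjoin0 T) (s : seq (adjoin0 T)) : Prop :=
  path <%O \bot s /\ forall y : adjoin0 T, (y \in \bot :: s) = (y <= x).

Definition has_rank (x : adjoin0 T) (n : nat) : Prop :=
  exists2 s, is_chain_to x s & size s = n.

Definition rooted_forest : Prop :=
  (forall y : adjoin0 T, y != \bot -> exists! x, covered_by x y) /\
  (forall x : adjoin0 T, exists n, has_rank x n).

End RootedForest.

(* The chain to [x] is unique when it exists, so there is at most one [n] to
   choose from; the default 0 is never reached in a rooted forest. *)
Definition rank0 (disp : Order.disp_t) (T : porderType disp)
  (x : adjoin0 T) : nat := xget 0%N [set n | has_rank x n].

Section Words.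
Context {disp : Order.disp_t} {T : porderType disp}.
Implicit Types u v w : seq T.

(* [all2] also requires the two words to have the same size. *)
Definition word_le u w : Prop :=
  exists2 s, subseq s w & all2 <=%O u s.

Definition word_lt u w : Prop := word_le u w /\ u <> w.

Definition word_rank w : nat := (\sum_(x <- w) rank0 (inj0 x))%N.

Definition open_interval u w : set (seq T) :=
  [set v | word_lt u v /\ word_lt v w].

Definition disconnected u w : Prop :=
  exists A B : set (seq T),
    [/\ A !=set0, B !=set0, A `|` B = open_interval u w, A `&` B = set0
      & forall a b, A a -> B b -> ~ word_le a b /\ ~ word_le b a].

Definition subinterval u' w' u w : Prop :=
  [/\ word_le u u', word_le u' w' & word_le w' w].

Definition has_nontrivial_disconnected_subinterval u w : Prop :=
  exists u' w', [/\ subinterval u' w' u w, disconnected u' w'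
                  & (3 <= word_rank w' - word_rank u')%N].

(* Letters are numbered from 0. *)
Definition letter w (i : nat) : adjoin0 T := nth \bot (map (@inj0 T) w) i.

Definition embedding (eta : seq (adjoin0 T)) u w : Prop :=
  [/\ size eta = size w,
      [seq x <- eta | x != \bot] = map (@inj0 T) u
    & forall i, (i < size w)%N -> nth \bot eta i <= letter w i].

End Words.

(* Main.v *)
Require Import Defs.
From HB Require Import structures.
From mathcomp Require Import all_boot all_order.
From mathcomp Require Import boolp classical_sets.
From mathcomp Require Import zify.

Set Implicit Arguments.
Unset Strict Implicit.
Unset Printing Implicit Defensive.

Import Order.TTheory.
Local Open Scope order_scope.

(** Both sides of the equivalence say that [u, w] contains a doubling, that
    is, words x a y and x a a y with u <= x a y, x a a y <= w and a of rank at
    least 3.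

    For the combinatorial side ([contains_doublingP]) this is a matter of
    reading positions: given an embedding eta with the stated properties,
    raising eta(i) to a gives x a y, and raising eta(j) to a as well gives
    x a a y; the zeros in between are what makes the two letters a adjacent.

    A doubling is disconnected ([disconnected_doubling]). An embedding of
    x a y in x a a y leaves out a single position, and when that position is
    in the left part x a, everything above the embedding keeps the suffix a y
    of the top; otherwise it keeps the prefix x a. So the open interval splits
    into words p a y and words x a q, and a comparison between two such words
    forces one of them to be an end of the interval.

    Conversely, let [u, w] be disconnected of rank at least 3. Each embedding
    eta of u gives a box [eta, w], a product of chains since P is a forest, and
    the words coming from all these boxes fill [u, w]. The open box is
    connected because two of its maximal elements, each of which lowers one
    letter of w to its parent, have a common lower bound lowering both letters
    ([lower_common_bound]); by rank this bound is still above u. If the open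
    interval is split into two parts, each box is thus inside one part. Any two
    embeddings are linked by slides of a single nonzero letter across a run of
    zeros ([slide_ind]), so some slide links boxes in different parts. Those
    two boxes have no maximal element in common, so at each position one of
    the two embeddings agrees with w. At a position where both are zero this
    is impossible, so the slide is between adjacent positions; this forces
    w = x a a y and u = x a y ([slide_rigid]), and the rank of a is the rank
    of the interval. *)

(** * Ranks and parents in a rooted forest *)

Section Rank.
Context {disp : Order.disp_t} {T : porderType disp}.
Implicit Types x y z : adjoin0 T.

Lemma path_le_last x s y : path <%O x s -> y \in x :: s -> y <= last x s.
Proof.
have -> : path <%O x s = sorted <%O (x :: s) by [].
rewrite lastI lt_sorted_pairwise pairwise_rcons => /andP[/allP below _].
by rewrite mem_rcons inE => /orP[/eqP-> // | /below /ltW].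
Qed.

Lemma rank0_chain x s : is_chain_to x s -> rank0 x = size s.
Proof.
move=> chain_s.
have [s' chain_s' <-] : has_rank x (rank0 x).
  by apply: (xgetPex 0%N); exists (size s), s.
have [] : \bot :: s' = \bot :: s; last by move=> ->.
apply: lt_sorted_eq; [exact: chain_s'.1 | exact: chain_s.1 |].
by move=> y; rewrite chain_s'.2 chain_s.2.
Qed.

Lemma rank0_bot : rank0 (\bot : adjoin0 T) = 0%N.
Proof.
by apply: (@rank0_chain _ [::]); split=> // y; rewrite inE lex0.
Qed.

Context (forestT : rooted_forest T).

(** The interval [0, x] is a finite chain; its last element but one is the
    parent. *)
Lemma forest_parent x : x != \bot ->
  exists c, [/\ c < x, forall z, z < x -> z <= c & rank0 x = (rank0 c).+1].
Proof.
move=> x_neq0; have [_ [s [path_s mem_s] _]] := forestT.2 x.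
case/lastP: s => [|s z] in path_s mem_s *.
  by move: (mem_s x) x_neq0; rewrite inE lexx => ->.
have z_x : z = x.
  apply: le_anti; rewrite -mem_s inE mem_rcons mem_head orbT /=.
  by have := path_le_last (y := x) path_s; rewrite last_rcons mem_s; apply.
rewrite {z}z_x in path_s mem_s.
have /andP[path_s' lt_last] : path <%O \bot s && (last \bot s < x).
  by rewrite -rcons_path.
have belowE y : y < x -> y \in \bot :: s.
  move=> lt_yx; have := mem_s y; rewrite (ltW lt_yx) inE mem_rcons !inE.
  by rewrite (lt_eqF lt_yx).
have chain_s : is_chain_to (last \bot s) s.
  split=> // y; apply/idP/idP; first exact: path_le_last.
  by move=> /le_lt_trans/(_ lt_last)/belowE.
exists (last \bot s); split=> // [y /belowE|]; first exact: path_le_last.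
by rewrite (rank0_chain chain_s) (@rank0_chain x (rcons s x)) ?size_rcons.
Qed.

Definition parent x : adjoin0 T :=
  xget \bot [set c | c < x /\ forall z, z < x -> z <= c]%classic.

Lemma parentP x : x != \bot ->
  [/\ parent x < x, forall z, z < x -> z <= parent x
    & rank0 x = (rank0 (parent x)).+1].
Proof.
move=> /forest_parent[c [lt_cx max_c rank_x]].
suff -> : parent x = c by [].
apply: xget_unique => [|d [lt_dx max_d]]; first by [].
by apply: le_anti; rewrite max_c ?max_d.
Qed.

End Rank.

(** Not a conversion: the strict order of [adjoin0 T] is derived from the large
    one. *)
Lemma lt_inj0 {disp : Order.disp_t} {T : porderType disp} (a b : T) :
  (inj0 a < inj0 b) = (a < b).
Proof. by rewrite !lt_neqAle. Qed.

(** * Words padded with zeros *)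

Section Padding.
Context {disp : Order.disp_t} {T : porderType disp}.
Implicit Types (u v w : seq T) (d e f : seq (adjoin0 T)).

(** A word over P_0 stands for the word over P left when its zeros are
    deleted. With this encoding v <= w means that v is obtained by lowering
    letters of w in place, possibly to zero, so that no indexing of subwords
    is needed. *)
Definition strip e : seq T := pmap id e.
Definition ple d e : bool := all2 <=%O d e.
Definition pad w : seq (adjoin0 T) := map (@inj0 T) w.

Lemma strip_cat d e : strip (d ++ e) = strip d ++ strip e.
Proof. exact: pmap_cat. Qed.

Lemma strip_pad w : strip (pad w) = w.
Proof. by elim: w => //= x w IH; congr (_ :: _). Qed.

Lemma strip_zeros n : strip (nseq n \bot) = [::].
Proof. by elim: n. Qed.

Lemma filter_strip e : [seq x <- e | x != \bot] = pad (strip e).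
Proof. by elim: e => [//|[x|] e IH] //=; congr (_ :: _). Qed.

Lemma nth_pad_neq0 w i : (i < size w)%N -> nth \bot (pad w) i != \bot.
Proof. by elim: w i => [//|x w IH] [|i] //=; apply: IH. Qed.

Lemma strip_cons_inv e b v : strip e = b :: v ->
  exists n f, e = nseq n \bot ++ inj0 b :: f /\ strip f = v.
Proof.
elim: e => [//|[x|] e IH] /=.
  by case=> <- <-; exists 0%N, e.
by move/IH => [n [f [-> <-]]]; exists n.+1, f.
Qed.

Lemma strip_cat_inv e u v : strip e = u ++ v ->
  exists d f, [/\ e = d ++ f, strip d = u & strip f = v].
Proof.
elim: u e => [|b u IH] e /=; first by exists [::], e.
move=> /strip_cons_inv[n [e' [-> /IH[d [f [-> <- <-]]]]]].
exists (nseq n \bot ++ inj0 b :: d), f.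
by rewrite strip_cat strip_zeros /= -catA.
Qed.

Lemma pleP d e :
  ple d e <-> size d = size e /\ forall i, nth \bot d i <= nth \bot e i.
Proof.
split.
  elim: d e => [|x d IH] [|y e] //= /andP[le_xy /IH[-> le_de]].
  by split=> // -[|i] /=.
elim: d e => [|x d IH] [|y e] [] //= [eq_size] le_de.
rewrite /ple /= (le_de 0%N) /=; apply: IH; split=> // i.
exact: le_de i.+1.
Qed.

Lemma ple_cons b c d e : ple (b :: d) (c :: e) = (b <= c) && ple d e.
Proof. by []. Qed.

Lemma ple_refl e : ple e e.
Proof. by apply/pleP. Qed.

Lemma ple_trans e d f : ple d e -> ple e f -> ple d f.
Proof.
move=> /pleP[s1 le1] /pleP[s2 le2]; apply/pleP; split; first by rewrite s1.
by move=> i; apply: le_trans (le2 i).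
Qed.

Lemma ple_size d e : ple d e -> size d = size e.
Proof. by move/pleP => []. Qed.

Lemma ple_cat d1 d2 e1 e2 : size d1 = size e1 ->
  ple (d1 ++ d2) (e1 ++ e2) = ple d1 e1 && ple d2 e2.
Proof.
by rewrite /ple !all2E !size_cat => eq1; rewrite zip_cat // all_cat eq1 eqxx
  eqn_add2l /= andbCA.
Qed.

(** The right-hand side may itself be padded; this is what makes transitivity
    and the refinement of embeddings immediate. *)
Lemma word_leP u e :
  word_le u (strip e) <-> exists2 d, ple d e & strip d = u.
Proof.
split=> [[s]|].
  elim: e s u => [|[x|] e IH] s u /=.
  - by case: s u => [|y s] [|b u] // _ _; exists [::].
  - case: s u => [|y s] [|b u] //=.
      move=> _ _; exists (nseq (size e).+1 \bot); last exact: strip_zeros.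
      by apply/pleP; rewrite size_nseq; split=> // i; rewrite nth_nseq if_same.
    case: eqP => [->|_] sub_s /andP[le_by le_us].
      have [d le_de <-] := IH _ _ sub_s le_us.
      by exists (inj0 b :: d) => //; apply/andP.
    have [|d le_de <-] := IH _ (b :: u) sub_s; first by rewrite /= le_by.
    by exists (\bot :: d).
  - by move=> /IH{}IH /IH[d le_de <-]; exists (\bot :: d).
move=> [d + <-]; elim: d e {u} => [|x d IH] [|y e] //=.
  by exists [::].
move=> /andP[le_xy /IH[s sub_s le_s]].
case: x y le_xy => [x|] [y|] //= le_xy.
- by exists (y :: s); rewrite /= ?eqxx //; apply/andP.
- by exists s => //; apply: subseq_trans sub_s (subseq_cons _ _).
- by exists s.
Qed.

Lemma word_le_pad u w :
  word_le u w <-> exists2 d, ple d (pad w) & strip d = u.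
Proof. by rewrite -{1}(strip_pad w); apply: word_leP. Qed.

Lemma embeddingP e u w : embedding e u w <-> ple e (pad w) /\ strip e = u.
Proof.
split=> [[s_e filter_e le_e]|[/pleP[s_e le_e] strip_e]]; split.
- apply/pleP; split=> [|k]; first by rewrite size_map.
  have [lt_k|le_k] := ltnP k (size w); first exact: le_e.
  by rewrite nth_default ?s_e // le0x.
- by rewrite -(strip_pad u) /pad -filter_e filter_strip strip_pad.
- by rewrite s_e size_map.
- by rewrite filter_strip strip_e.
- by move=> k _; apply: le_e.
Qed.

Lemma ple_word_le d e : ple d e -> word_le (strip d) (strip e).
Proof. by move=> le_de; apply/word_leP; exists d. Qed.

Lemma word_le_refl u : word_le u u.
Proof. by rewrite -(strip_pad u); apply/ple_word_le/ple_refl. Qed.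

Lemma word_le_trans v u w : word_le u v -> word_le v w -> word_le u w.
Proof.
move=> le_uv /word_le_pad[e le_ew ev]; rewrite -ev in le_uv.
have [d le_de <-] := (word_leP _ _).1 le_uv.
by apply/word_le_pad; exists d => //; apply: ple_trans le_ew.
Qed.

Lemma word_le_size u w : word_le u w -> (size u <= size w)%N.
Proof. by move=> [s /size_subseq le_sw]; rewrite all2E => /andP[/eqP-> _]. Qed.

Lemma word_le_anti u w : word_le u w -> word_le w u -> u = w.
Proof.
move=> le_uw le_wu.
have eq_size : size u = size w.
  by apply/eqP; rewrite eqn_leq !word_le_size.
have all2_le v1 v2 : size v1 = size v2 -> word_le v1 v2 -> all2 <=%O v1 v2.
  move=> eq12 [s sub_s le_s]; suff <- : s = v2 by [].
  apply/eqP; rewrite -(size_subseq_leqif sub_s) -eq12.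
  by move: le_s; rewrite all2E => /andP[/eqP->].
move: (all2_le _ _ eq_size le_uw) (all2_le _ _ (esym eq_size) le_wu).
elim: u w {le_uw le_wu eq_size} => [|x u IH] [|y w] //=.
by move=> /andP[le1 /IH{}IH] /andP[le2 /IH->]; rewrite (@le_anti _ _ x y) ?le1.
Qed.

Lemma word_le_cat u1 u2 w1 w2 :
  word_le u1 w1 -> word_le u2 w2 -> word_le (u1 ++ u2) (w1 ++ w2).
Proof.
move=> /word_le_pad[d1 le1 <-] /word_le_pad[d2 le2 <-].
apply/word_le_pad; exists (d1 ++ d2); last exact: strip_cat.
by rewrite /pad map_cat ple_cat ?le1 //; apply: ple_size.
Qed.

Lemma word_le_cat_inv v w1 w2 : word_le v (w1 ++ w2) ->
  exists v1 v2, [/\ v = v1 ++ v2, word_le v1 w1 & word_le v2 w2].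
Proof.
move=> /word_le_pad[d + <-]; rewrite /pad map_cat -(cat_take_drop (size w1) d).
move=> le_d; have size_d := ple_size le_d.
rewrite ple_cat in le_d; last first.
  rewrite cat_take_drop size_cat !size_map in size_d.
  by rewrite size_map size_takel // size_d leq_addr.
move: le_d => /andP[le1 le2].
exists (strip (take (size w1) d)), (strip (drop (size w1) d)).
by split; [exact: strip_cat | apply/word_le_pad; eexists; [exact: le1|] |
  apply/word_le_pad; eexists; [exact: le2|]].
Qed.

Lemma word_le_insert u v w : word_le (u ++ w) (u ++ v ++ w).
Proof.
exists (u ++ w); first exact: cat_subseq (subseq_refl u) (suffix_subseq v w).
by elim: (u ++ w) => //= z t ->; rewrite lexx.
Qed.

Lemma word_le_letter u w (a b : T) :
  b <= a -> word_le (u ++ b :: w) (u ++ a :: w).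
Proof.
move=> le_ba; apply: word_le_cat; first exact: word_le_refl.
exists (a :: w); first exact: subseq_refl.
apply/andP; split=> //.
by elim: w => //= z t ->; rewrite lexx.
Qed.

Lemma word_rank_cat u w : word_rank (u ++ w) = (word_rank u + word_rank w)%N.
Proof. exact: big_cat. Qed.

Lemma word_rank_cons (a : T) w :
  word_rank (a :: w) = (rank0 (inj0 a) + word_rank w)%N.
Proof. exact: big_cons. Qed.

End Padding.

Arguments ple : simpl never.

(** * A doubling is disconnected *)

Section Doubling.
Context {disp : Order.disp_t} {T : porderType disp}.
Implicit Types (u v w x y p q : seq T) (a : T).

Lemma cat_inj u v w w' : size u = size v -> u ++ w = v ++ w' -> u = v /\ w = w'.
Proof. by move=> eq_s /eqP; rewrite eqseq_cat // => /andP[/eqP-> /eqP->]. Qed.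

(** Cut x a a y after x a. A word v of the interval is cut accordingly, and so
    is x a y inside v; the size of the left part of x a y tells which side has
    lost a letter, and the other side is squeezed between equal words. *)
Lemma doubling_cover x a y v :
  word_le (x ++ a :: y) v -> word_le v (x ++ a :: a :: y) ->
  (exists p, [/\ v = p ++ a :: y, word_le x p & word_le p (x ++ [:: a])]) \/
  (exists q, [/\ v = x ++ a :: q, word_le y q & word_le q (a :: y)]).
Proof.
rewrite -(cat1s a (a :: y)) catA.
move=> le_uv /word_le_cat_inv[v1 [v2 [def_v le_v1 le_v2]]].
rewrite {v}def_v in le_uv *.
have [u1 [u2 [def_u le_u1 le_u2]]] := word_le_cat_inv le_uv.
have s1 := word_le_size (word_le_trans le_u1 le_v1).
have s2 := word_le_size (word_le_trans le_u2 le_v2).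
have /eqP := congr1 size def_u.
rewrite !size_cat /= in s1 s2 *; rewrite addn1 in s1.
move: s1; rewrite leq_eqVlt => /orP[/eqP s1 _|].
  right; move/eqP: def_u; rewrite -cat1s catA eqseq_cat; last first.
    by rewrite size_cat addn1 s1.
  case/andP=> /eqP def_u1 /eqP def_u2; rewrite -def_u1 -def_u2 in le_u1 le_u2.
  rewrite -(word_le_anti le_u1 le_v1) -catA cat1s.
  by exists v2; split=> //; rewrite -?def_u2.
rewrite ltnS => s1 /eqP sE.
have {}s1 : size u1 = size x.
  apply/eqP; rewrite eqn_leq s1 /= -(leq_add2r (size y).+1) sE leq_add2l.
  exact: s2.
left; move/eqP: def_u; rewrite eqseq_cat // => /andP[/eqP def_u1 /eqP def_u2].
rewrite -def_u1 -def_u2 in le_u1 le_u2.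
by exists v1; split=> //; rewrite -(word_le_anti le_u2 le_v2).
Qed.

(** A word p a y below or above a word x a q is an end of the interval, or the
    other one is. Cutting the larger word splits the smaller one, and sizes
    leave two ways of doing so, each of which ends with antisymmetry. *)
Lemma doubling_apart x a y p q :
  word_le x p -> word_le p (x ++ [:: a]) ->
  word_le y q -> word_le q (a :: y) ->
  word_le (p ++ a :: y) (x ++ a :: q) \/ word_le (x ++ a :: q) (p ++ a :: y) ->
  [\/ p ++ a :: y = x ++ a :: y, p ++ a :: y = x ++ a :: a :: y,
      x ++ a :: q = x ++ a :: y | x ++ a :: q = x ++ a :: a :: y].
Proof.
move=> le_xp le_px le_yq le_qy.
have [s_xp s_px] := (word_le_size le_xp, word_le_size le_px).
have [s_yq s_qy] := (word_le_size le_yq, word_le_size le_qy).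
rewrite size_cat addn1 in s_px.
case.
  rewrite -(cat1s a q) catA => /word_le_cat_inv[r1 [r2 [E le_r1 le_r2]]].
  have := word_le_size le_r1; rewrite size_cat addn1 => s_r1.
  have /= s_r2 := leq_trans (word_le_size le_r2) s_qy.
  have := congr1 size E; rewrite !size_cat /= => s_E.
  have [eq_s|neq_s] := eqVneq (size r1) (size p).
    have [def_r1 def_r2] := cat_inj (esym eq_s) E.
    constructor 4; rewrite -def_r2 in le_r2.
    by rewrite (word_le_anti le_qy le_r2) -catA.
  have s_p : size p = size x by lia.
  have [def_r1 def_r2] : p ++ [:: a] = r1 /\ y = r2.
    by apply: cat_inj; [rewrite size_cat /=; lia | rewrite -catA].
  constructor 1; congr (_ ++ _); apply: word_le_anti => //.
  rewrite -def_r1 in le_r1.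
  have [r3 [r4 [E' le_r3 le_r4]]] := word_le_cat_inv le_r1.
  have /= := word_le_size le_r4; have := word_le_size le_r3.
  have := congr1 size E'; rewrite !size_cat /= => s_E' s_r3 s_r4.
  by have [|-> _] := cat_inj _ E'; first by lia.
move=> /word_le_cat_inv[r1 [r2 [E le_r1 le_r2]]].
have s_r1 := leq_trans (word_le_size le_r1) s_px.
have /= s_r2 := word_le_size le_r2.
have := congr1 size E; rewrite !size_cat /= => s_E.
have [eq_s|neq_s] := eqVneq (size r1) (size x).
  have [def_r1 def_r2] := cat_inj (esym eq_s) E.
  constructor 3; congr (_ ++ _ :: _); apply: word_le_anti => //.
  rewrite -def_r2 -(cat1s a y) in le_r2.
  have [r3 [r4 [E' le_r3 le_r4]]] := word_le_cat_inv le_r2.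
  have /= := word_le_size le_r3; have := word_le_size le_r4.
  have := congr1 size E'; rewrite !size_cat /= => s_E' s_r4 s_r3.
  by have [|_ ->] := @cat_inj [:: a] r3 q r4 _ E'; first by rewrite /=; lia.
have [def_r1 _] : x ++ [:: a] = r1 /\ q = r2.
  by apply: cat_inj; [rewrite size_cat /=; lia | rewrite -catA].
constructor 2; rewrite -def_r1 in le_r1.
by rewrite (word_le_anti le_px le_r1) -catA.
Qed.

(** A letter b strictly below a gives x b a y and x a b y, one in each part. *)
Lemma disconnected_doubling x a b y : b < a ->
  disconnected (x ++ a :: y) (x ++ a :: a :: y).
Proof.
move=> lt_ba; set u := x ++ a :: y; set w := x ++ a :: a :: y.
have insertE v : size v = size w -> word_le u v -> word_le v w -> v <> w ->
    open_interval u w v.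
  move=> s_v le_uv le_vw neq_vw; split; split=> // def_v.
  by have := congr1 size def_v; rewrite s_v !size_cat /=; lia.
pose A := [set v | open_interval u w v /\ exists p,
  [/\ v = p ++ a :: y, word_le x p & word_le p (x ++ [:: a])]]%classic.
pose B := [set v | open_interval u w v /\
  exists q, [/\ v = x ++ a :: q, word_le y q & word_le q (a :: y)]]%classic.
have apart v v' : A v -> B v' -> ~ (word_le v v' \/ word_le v' v).
  move=> [[[_ neq_uv] [_ neq_vw]] [p [def_v le_xp le_px]]].
  move=> [[[_ neq_uv'] [_ neq_v'w]] [q [def_v' le_yq le_qy]]].
  rewrite def_v def_v' => /(doubling_apart le_xp le_px le_yq le_qy).
  by rewrite -def_v -def_v' => -[] eq_v; [case: neq_uv|case: neq_vw|
    case: neq_uv'|case: neq_v'w].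
exists A, B; split.
- exists (x ++ b :: a :: y); split.
    apply: insertE; first by rewrite !size_cat.
    + exact: (word_le_insert x [:: b]).
    + exact/word_le_letter/ltW.
    + by case/(cat_inj erefl) => _ [] /eqP; rewrite (lt_eqF lt_ba).
  exists (x ++ [:: b]); rewrite -catA; split=> //.
    by have := word_le_insert x [:: b] [::]; rewrite !cats0.
  exact/word_le_letter/ltW.
- exists (x ++ a :: b :: y); split; last first.
    exists (b :: y); split=> //; first exact: (word_le_insert [::] [:: b]).
    exact/(@word_le_letter _ _ [::])/ltW.
  apply: insertE; first by rewrite !size_cat.
  + by have := word_le_insert (x ++ [:: a]) [:: b] y; rewrite -!catA.
  + by have := word_le_letter (x ++ [:: a]) y (ltW lt_ba); rewrite -!catA.
  + by case/(cat_inj erefl) => _ [/eqP]; rewrite (lt_eqF lt_ba).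
- apply/seteqP; split=> [v [[]|[]]//|v open_v].
  have [[le_uv _] [le_vw _]] := open_v.
  by have [] := doubling_cover le_uv le_vw; [left|right].
- apply/seteqP; split=> // v [Av Bv]; case: (apart v v Av Bv).
  by left; apply: word_le_refl.
- move=> v v' Av Bv'; have := apart _ _ Av Bv'.
  by move=> nle; split=> le; apply: nle; [left|right].
Qed.

Definition contains_doubling u w : Prop := exists x a y,
  [/\ (3 <= rank0 (inj0 a))%N, word_le u (x ++ a :: y)
    & word_le (x ++ a :: a :: y) w].

Lemma contains_doubling_disconnected u w : rooted_forest T ->
  contains_doubling u w -> has_nontrivial_disconnected_subinterval u w.
Proof.
move=> forestT [x [a [y [rank_a le_u le_w]]]].
exists (x ++ a :: y), (x ++ a :: a :: y); split.
- by split=> //; apply: (word_le_insert x [:: a]).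
- have [//|] := @parentP _ _ forestT (inj0 a).
  case: (parent _) => [b|] lt_ba _ rank_b.
    by apply: (@disconnected_doubling _ _ b); rewrite -lt_inj0.
  by move: rank_a; rewrite rank_b rank0_bot.
- rewrite !word_rank_cat !word_rank_cons; lia.
Qed.

(** * Doublings read off an embedding *)

Section Blocks.
Implicit Types (e f s t : seq (adjoin0 T)) (b c : adjoin0 T).

Definition block s b n c t := s ++ b :: nseq n \bot ++ c :: t.

Lemma nth_block_l s b n c t : nth \bot (block s b n c t) (size s) = b.
Proof. by rewrite nth_cat ltnn subnn. Qed.

Lemma nth_block_r s b n c t : nth \bot (block s b n c t) (size s + n.+1) = c.
Proof.
rewrite nth_cat ltnNge leq_addr /= addKn /=.
by rewrite nth_cat size_nseq ltnn subnn.
Qed.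

Lemma nth_block_mid s b n c t k :
  (size s < k < size s + n.+1)%N -> nth \bot (block s b n c t) k = \bot.
Proof.
move=> /andP[lt1 lt2]; rewrite nth_cat ltnNge (ltnW lt1) /=.
case def_k: (k - size s)%N => [|k'] /=; first by lia.
by rewrite nth_cat size_nseq ifT ?nth_nseq ?if_same //; lia.
Qed.

Lemma size_block s b n c t :
  size (block s b n c t) = (size s + n.+2 + size t)%N.
Proof. by rewrite size_cat /= size_cat size_nseq /=; lia. Qed.

Lemma strip_block s b n c t :
  strip (block s b n c t) = strip s ++ strip [:: b] ++ strip [:: c] ++ strip t.
Proof.
by rewrite /block -cat1s -(cat1s c) !strip_cat strip_zeros.
Qed.

Lemma ple_block s b b' n c c' t :
  b <= b' -> c <= c' -> ple (block s b n c t) (block s b' n c' t).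
Proof.
by move=> le_b le_c; rewrite !(ple_cat, ple_cons) // !ple_refl le_b le_c.
Qed.

Lemma block_of_zeros e i j : (i < j < size e)%N ->
  (forall k, (i < k <= j)%N -> nth \bot e k = \bot) ->
  exists s n t,
    [/\ size s = i, (i + n.+1)%N = j & e = block s (nth \bot e i) n \bot t].
Proof.
move=> /andP[lt_ij lt_je] zeros; exists (take i e), (j - i.+1)%N, (drop j.+1 e).
have s_i : size (take i e) = i by rewrite size_takel //; lia.
split=> //; first by lia.
rewrite /block; have -> : \bot :: drop j.+1 e = drop j e.
  by rewrite [RHS](drop_nth \bot) // zeros //; lia.
set b := nth _ _ _; rewrite -{1}(cat_take_drop i e); congr (_ ++ _).
rewrite (drop_nth \bot); last exact: ltn_trans lt_ij lt_je.
congr (_ :: _); rewrite -{1}(cat_take_drop (j - i.+1) (drop i.+1 e)).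
rewrite drop_drop subnK //; congr (_ ++ _).
have s_t : size (take (j - i.+1) (drop i.+1 e)) = (j - i.+1)%N.
  by rewrite size_takel // size_drop leq_sub2r // ltnW.
apply: (@eq_from_nth _ \bot); rewrite s_t ?size_nseq // => k lt_k.
by rewrite nth_take // nth_drop nth_nseq if_same zeros //; lia.
Qed.

Lemma ple_block_raise s b n c t b' c' f :
  ple (block s b n c t) f -> b' <= nth \bot f (size s) ->
  c' <= nth \bot f (size s + n.+1) -> ple (block s b' n c' t) f.
Proof.
set e := block s b n c t => /pleP[s_e le_e] le_b le_c; apply/pleP; split.
  by rewrite -s_e !size_block.
have set_cat r d d' r' :
    set_nth \bot (r ++ d :: r') (size r) d' = r ++ d' :: r'.
  by elim: r => //= x r ->.
have -> : block s b' n c' t =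
    set_nth \bot (set_nth \bot e (size s) b') (size s + n.+1) c'.
  rewrite set_cat -cat_cons catA.
  have -> : (size s + n.+1)%N = size (s ++ b' :: nseq n \bot).
    by rewrite size_cat /= size_nseq.
  by rewrite set_cat -catA.
move=> k; rewrite nth_set_nth /=; case: eqP => [->//|_].
by rewrite nth_set_nth /=; case: eqP => [->|].
Qed.

End Blocks.

(** The zeros of eta after position i are what makes the two letters a, placed
    at i and j, adjacent once zeros are deleted. *)
Lemma contains_doublingP u w : contains_doubling u w <->
  exists (eta : seq (adjoin0 T)) (a : adjoin0 T) (i j : nat),
    [/\ embedding eta u w, (3 <= rank0 a)%N & (i < j < size w)%N] /\
    [/\ nth \bot eta i <= a <= letter w i,
        a <= letter w j
      & forall k, (i < k <= j)%N -> nth \bot eta k = \bot].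
Proof.
split.
  move=> [x [a [y [rank_a le_u /word_le_pad[f le_f strip_f]]]]].
  have [f1 [g [def_f strip_f1 /strip_cons_inv]]] := strip_cat_inv strip_f.
  move=> [n [g' [def_g /strip_cons_inv[m [f2 [def_g' strip_f2]]]]]].
  (* In an embedding of x a a y in w, replace the second a by zero: embeddings
     of u below the result vanish after the first a up to that position. *)
  pose s := f1 ++ nseq n \bot; pose e := block s (inj0 a) m \bot f2.
  have strip_e : strip e = x ++ a :: y.
    by rewrite strip_block strip_cat strip_zeros cats0 strip_f1 strip_f2.
  have {}def_f : f = block s (inj0 a) m (inj0 a) f2.
    by rewrite def_f def_g def_g' catA.
  have le_ef : ple e f by rewrite def_f; apply: ple_block; rewrite ?lexx.
  rewrite -strip_e in le_u; have [d le_de strip_d] := (word_leP _ _).1 le_u.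
  have le_dw : ple d (pad w) by apply: ple_trans (ple_trans le_de le_ef) le_f.
  have [s_f le_fw] := (pleP _ _).1 le_f.
  have [_ {}le_de] := (pleP _ _).1 le_de.
  exists d, (inj0 a), (size s), (size s + m.+1)%N; do 2!split=> //.
  - exact/embeddingP.
  - rewrite addnS ltnS leq_addr /= -(size_map (@inj0 T)) -s_f def_f.
    by rewrite size_block; lia.
  - have := le_de (size s); rewrite nth_block_l => -> /=.
    by have := le_fw (size s); rewrite {1}def_f nth_block_l.
  - by have := le_fw (size s + m.+1)%N; rewrite {1}def_f nth_block_r.
  - move=> k /andP[lt_k]; apply: contraTeq => d_k; apply/negP => le_k.
    case/negP: d_k; rewrite -lex0; apply: le_trans (le_de k) _.
    move: le_k; rewrite leq_eqVlt => /orP[/eqP->|lt_k'].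
      by rewrite nth_block_r.
    by rewrite nth_block_mid ?lt_k.
move=> [e [a [i [j [[/embeddingP[le_ew strip_e] rank_a lt_ij]]]]]].
move=> [/andP[le_ea le_ai] le_aj zeros_e].
case: a rank_a le_ea le_ai le_aj => [a|]; last by rewrite rank0_bot.
move=> rank_a le_ea le_ai le_aj.
have := ple_size le_ew; rewrite size_map => s_e.
rewrite -s_e in lt_ij.
have [s [n [t [s_i ij def_e]]]] := block_of_zeros lt_ij zeros_e.
exists (strip s), a, (strip t); split=> //.
  have -> : strip s ++ a :: strip t = strip (block s (inj0 a) n \bot t).
    by rewrite strip_block.
  by rewrite -strip_e def_e; apply/ple_word_le/ple_block.
have -> : strip s ++ a :: a :: strip t = strip (block s (inj0 a) n (inj0 a) t).
  by rewrite strip_block.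
apply/word_le_pad; eexists; last by [].
by rewrite def_e in le_ew; apply: ple_block_raise le_ew _ _; rewrite s_i ?ij.
Qed.

End Doubling.

(** * Sliding letters between embeddings *)

Section Boxes.
Context {disp : Order.disp_t} {T : porderType disp}.
Implicit Types (u v w : seq T) (d e f s t : seq (adjoin0 T)).

Definition pad_rank e : nat := \sum_(x <- e) rank0 x.

Lemma word_rank_strip e : word_rank (strip e) = pad_rank e.
Proof.
elim: e => [|[x|] e IH]; rewrite /pad_rank /word_rank ?big_nil //= big_cons.
  by rewrite big_cons; congr (_ + _)%N.
by rewrite rank0_bot add0n.
Qed.

Lemma pad_rank_set_nth e i x : (i < size e)%N ->
  (pad_rank (set_nth \bot e i x) + rank0 (nth \bot e i) =
   pad_rank e + rank0 x)%N.
Proof.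
rewrite /pad_rank; elim: e i => [|y e IH] [|i] //= lt_i; rewrite !big_cons.
  by rewrite addnC addnA addnAC.
by rewrite -addnA IH // addnA.
Qed.

(** Induction principle: embeddings of the same word are linked by slides. If
    one of them starts with zero and the other does not, the next nonzero
    letter of the former can be slid back to the front, since it is the first
    letter of the latter and so fits there; then the two agree on one more
    letter. *)
Lemma slide_ind (f : seq (adjoin0 T)) (C : seq (adjoin0 T) -> Prop) :
  (forall s (b : T) n t,
     ple (block s (inj0 b) n \bot t) f -> ple (block s \bot n (inj0 b) t) f ->
     (C (block s (inj0 b) n \bot t) <-> C (block s \bot n (inj0 b) t))) ->
  forall d e, ple d f -> ple e f -> strip d = strip e -> C d -> C e.
Proof.
elim: f C => [|z f IH] C slideC [|x d] [|y e] //.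
have consC c : c <= z -> forall d e, ple d f -> ple e f -> strip d = strip e ->
    C (c :: d) -> C (c :: e).
  move=> le_cz; apply: (IH (fun e => C (c :: e))) => s b n t le1 le2.
  by apply: (slideC (c :: s)); rewrite /block /= ple_cons le_cz.
rewrite !ple_cons => /andP[le_x le_d] /andP[le_y le_e].
case: x y le_x le_y => [x|] [y|] le_x le_y.
- by move=> [-> eq_de]; apply: consC le_y _ _ le_d le_e eq_de.
- move=> eq_de.
  have [n [e' [def_e strip_e']]] : exists n e',
    e = nseq n \bot ++ inj0 x :: e' /\ strip e' = strip d.
    exact: (@strip_cons_inv _ _ e x (strip d) (esym eq_de)).
  rewrite {}def_e in le_e *.
  have le_late : ple (block [::] \bot n (inj0 x) e') (z :: f).
    by rewrite /block /= ple_cons le0x.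
  have le_early : ple (block [::] (inj0 x) n \bot e') (z :: f).
    by apply: (ple_block_raise le_late); rewrite ?le0x.
  move=> C_d; apply/(slideC _ _ _ _ le_early le_late).
  move: le_early; rewrite /block /= ple_cons => /andP[_ le_e'].
  apply: consC le_x _ _ le_d le_e' _ C_d.
  by rewrite strip_cat strip_zeros /= strip_e'.
- move=> eq_de.
  have [n [d' [def_d strip_d']]] : exists n d',
    d = nseq n \bot ++ inj0 y :: d' /\ strip d' = strip e.
    exact: (@strip_cons_inv _ _ d y (strip e) eq_de).
  rewrite {}def_d in le_d *.
  have le_late : ple (block [::] \bot n (inj0 y) d') (z :: f).
    by rewrite /block /= ple_cons le0x.
  have le_early : ple (block [::] (inj0 y) n \bot d') (z :: f).
    by apply: (ple_block_raise le_late); rewrite ?le0x.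
  move=> /(slideC _ _ _ _ le_early le_late).
  move: le_early; rewrite /block /= ple_cons => /andP[_ le_d'].
  apply: consC le_y _ _ le_d' le_e _.
  by rewrite strip_cat strip_zeros /= strip_d'.
- by move=> eq_de; apply: consC le_x _ _ le_d le_e eq_de.
Qed.

(** A position strictly inside the run of zeros would be zero in both words,
    but w has no zero letter; so the run is empty. Then b, being nonzero in one
    word where the other has zero, is the letter of w at both positions. *)
Lemma slide_rigid w s b n t :
  ple (block s b n \bot t) (pad w) ->
  (forall k, nth \bot (block s b n \bot t) k = nth \bot (pad w) k \/
     nth \bot (block s \bot n b t) k = nth \bot (pad w) k) ->
  n = 0%N /\ pad w = block s b 0 b t.
Proof.
move=> /ple_size; rewrite size_map => s_w cases.
have n0 : n = 0%N.
  case: n s_w cases => // n; rewrite size_block => s_w /(_ (size s).+1).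
  have /nth_pad_neq0 : ((size s).+1 < size w)%N by lia.
  rewrite !nth_block_mid ?ltnS ?leqnn ?addnS ?leq_addr // => W_k.
  by case=> W_k0; rewrite -W_k0 eqxx in W_k.
rewrite {}n0 in s_w cases *; split=> //.
apply: (@eq_from_nth _ \bot); first by rewrite size_map -s_w !size_block.
move=> k; rewrite size_map => lt_k; have := cases k; have := nth_pad_neq0 lt_k.
rewrite /block /= !nth_cat; case: ltnP => _ W_k; first by case.
by case: (k - size s)%N => [|[|i]] /= [] W_k' //; rewrite -W_k' eqxx in W_k.
Qed.

(** * Boxes and the converse *)

Definition lower w k : seq (adjoin0 T) :=
  set_nth \bot (pad w) k (parent (letter w k)).

Section Box.
Context (forestT : rooted_forest T).

Lemma below_parent w e k : nth \bot e k < letter w k ->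
  [/\ (k < size (pad w))%N, nth \bot e k <= parent (letter w k),
      parent (letter w k) <= letter w k &
      rank0 (letter w k) = (rank0 (parent (letter w k))).+1].
Proof.
move=> lt_k; have w_k : letter w k != \bot.
  by rewrite -lt0x (le_lt_trans (le0x _) lt_k).
have [/ltW lt1 max1 rank1] := parentP forestT w_k; split=> //; last exact: max1.
rewrite ltnNge; apply: contra w_k => le_k.
by apply/eqP; apply: nth_default le_k.
Qed.

(** Deleting zeros is not injective, so that d differs from e does not by itself
    show that its word differs from u; ranks, which zeros do not affect, do. *)
Lemma open_interval_strip e d u w : embedding e u w -> ple e d ->
  ple d (pad w) -> (word_rank u < pad_rank d < word_rank w)%N ->
  open_interval u w (strip d).
Proof.
move=> /embeddingP[_ strip_e] le_ed le_dw /andP[lt_ud lt_dw].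
split; split=> [|eq_w].
- by rewrite -strip_e; apply: ple_word_le.
- by rewrite eq_w word_rank_strip ltnn in lt_ud.
- by rewrite -(strip_pad w); apply: ple_word_le.
- by rewrite -eq_w word_rank_strip ltnn in lt_dw.
Qed.

Lemma pad_rank_pad w : pad_rank (pad w) = word_rank w.
Proof. by rewrite -word_rank_strip strip_pad. Qed.

Lemma size_lower w k : (k < size (pad w))%N -> size (lower w k) = size (pad w).
Proof. by move=> lt_k; rewrite size_set_nth (maxn_idPr _). Qed.

Lemma lower_open e u w k : embedding e u w ->
  nth \bot e k < letter w k -> (2 <= word_rank w - word_rank u)%N ->
  open_interval u w (strip (lower w k)).
Proof.
move=> emb_e /below_parent[lt_k le1 le2 rank_k] rank_uw.
have [/pleP[s_e le_e] _] := (embeddingP _ _ _).1 emb_e.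
apply: (open_interval_strip emb_e).
- apply/pleP; split=> [|i]; first by rewrite size_lower.
  by rewrite nth_set_nth /=; case: eqP => [->|].
- apply/pleP; split=> [|i]; first by rewrite size_lower.
  by rewrite nth_set_nth /=; case: eqP => [->|].
- have := pad_rank_set_nth (parent (letter w k)) lt_k.
  by rewrite -/(lower w k) rank_k pad_rank_pad; lia.
Qed.

(** Lowering both letters removes rank 2, so rank 3 leaves room above u. *)
Lemma lower_common_bound e u w k l : embedding e u w ->
  nth \bot e k < letter w k -> nth \bot e l < letter w l ->
  (3 <= word_rank w - word_rank u)%N ->
  exists2 v, open_interval u w v &
    word_le v (strip (lower w k)) /\ word_le v (strip (lower w l)).
Proof.
move=> emb_e lt_ek lt_el rank_uw.
have [->|neq_lk] := eqVneq l k.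
  exists (strip (lower w k)); last by split; apply: word_le_refl.
  exact: lower_open emb_e lt_ek (ltnW rank_uw).
have [lt_k le1 le2 rank_k] := below_parent lt_ek.
have [lt_l le1' le2' rank_l] := below_parent lt_el.
have [/pleP[s_e le_e] _] := (embeddingP _ _ _).1 emb_e.
pose m := set_nth \bot (lower w k) l (parent (letter w l)).
have nth_m i : nth \bot m i = if i == l then parent (letter w l) else
    if i == k then parent (letter w k) else nth \bot (pad w) i.
  by rewrite /m nth_set_nth /=; case: eqP => // _; rewrite nth_set_nth.
have s_m : size m = size (pad w).
  by rewrite size_set_nth size_lower ?(maxn_idPr _).
exists (strip m); last split.
- apply: (open_interval_strip emb_e).
  + apply/pleP; split=> [|i]; first by rewrite s_m.
    by rewrite nth_m; case: eqP => [->|_] //; case: eqP => [->|].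
  + apply/pleP; split=> [|i]; first by rewrite s_m.
    by rewrite nth_m; case: eqP => [->|_] //; case: eqP => [->|].
  + have := pad_rank_set_nth (parent (letter w k)) lt_k.
    have := @pad_rank_set_nth (lower w k) l (parent (letter w l)).
    rewrite size_lower // => /(_ lt_l).
    rewrite -/m -/(lower w k) nth_set_nth /=.
    by rewrite (negbTE neq_lk) rank_k rank_l pad_rank_pad; lia.
- apply/ple_word_le/pleP; split=> [|i]; first by rewrite s_m size_lower.
  rewrite nth_m nth_set_nth /=.
  by case: eqP => [->|] //; rewrite (negbTE neq_lk).
- apply/ple_word_le/pleP; split=> [|i]; first by rewrite s_m size_lower.
  by rewrite nth_m nth_set_nth /=; case: eqP => // _; case: eqP => [->|].
Qed.

(** Every word of the open interval lies in some box, hence below one of the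
    maximal elements of that box. *)
Lemma open_interval_le_lower u w v : open_interval u w v ->
  exists e k, [/\ embedding e u w, nth \bot e k < letter w k
    & word_le v (strip (lower w k))].
Proof.
move=> [[le_uv neq_uv] [le_vw neq_vw]].
have [d le_dw strip_d] := (word_le_pad _ _).1 le_vw.
rewrite -strip_d in le_uv; have [e le_ed strip_e] := (word_leP _ _).1 le_uv.
have [s_d le_d] := (pleP _ _).1 le_dw.
have [k lt_k] : exists k, nth \bot d k < letter w k.
  apply: contrapT => eq_dw; case: neq_vw; rewrite -strip_d.
  have -> : d = pad w; last exact: strip_pad.
  apply: (@eq_from_nth _ \bot) => // k _; apply/eqP.
  apply: contrapT => /negP neq_k.
  by apply: eq_dw; exists k; rewrite lt_neqAle neq_k; apply: le_d.
exists e, k; split.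
- by apply/embeddingP; split; first exact: ple_trans le_dw.
- by apply: le_lt_trans lt_k; have [_] := (pleP _ _).1 le_ed.
have [lt_kw le1 _ _] := below_parent lt_k.
rewrite -strip_d; apply/ple_word_le/pleP; split=> [|i].
  by rewrite size_lower.
by rewrite nth_set_nth /=; case: eqP => [->|].
Qed.

(** If no doubling existed, every slide would join two boxes with a maximal
    element in common, and the open interval would be connected. *)
Lemma disconnected_contains_doubling u w :
  disconnected u w -> (3 <= word_rank w - word_rank u)%N ->
  contains_doubling u w.
Proof.
move=> [A [B [[a Aa] [b Bb] AUB AIB apart]]] rank_uw.
apply: contrapT => no_doubling.
have notAB v : A v -> B v -> False.
  by move=> Av Bv; have : (set0 : set (seq T)) v by rewrite -AIB; split.
have comparable v v' : open_interval u w v -> open_interval u w v' ->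
    word_le v v' -> A v <-> A v'.
  rewrite -AUB => -[Av|Bv] [Av'|Bv'] le_vv' //.
  - by case: (apart _ _ Av Bv').
  - by case: (apart _ _ Av' Bv).
  - by split=> [/notAB|/notAB]; [case/(_ Bv) | case/(_ Bv')].
(* [C e] says that the box of the embedding e meets A; by [box_connected] its
   maximal elements are then all in A. *)
pose K k := A (strip (lower w k)).
pose C e := exists2 k, nth \bot e k < letter w k & K k.
have box_connected e k l : embedding e u w -> nth \bot e k < letter w k ->
    nth \bot e l < letter w l -> K k -> K l.
  move=> emb_e lt_k lt_l.
  have [v open_v [le_vk le_vl]] := lower_common_bound emb_e lt_k lt_l rank_uw.
  have open_k := lower_open emb_e lt_k (ltnW rank_uw).
  have open_l := lower_open emb_e lt_l (ltnW rank_uw).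
  move=> /(comparable _ _ open_v open_k le_vk).
  by move/(comparable _ _ open_v open_l le_vl).
have shared d e k : embedding d u w -> embedding e u w ->
    nth \bot d k < letter w k -> nth \bot e k < letter w k -> C d -> C e.
  move=> emb_d emb_e lt_d lt_e [l lt_l K_l]; exists k => //.
  exact: box_connected emb_d lt_l lt_d K_l.
have slideC s c n t : let d := block s (inj0 c) n \bot t in
    let e := block s \bot n (inj0 c) t in
    embedding d u w -> embedding e u w -> C d <-> C e.
  move=> d e emb_d emb_e.
  have [[k [lt_d lt_e]]|none] := pselect (exists k,
      nth \bot d k < letter w k /\ nth \bot e k < letter w k).
    by split; [apply: shared lt_d lt_e | apply: shared lt_e lt_d].
  have [le_d strip_d] := (embeddingP _ _ _).1 emb_d.
  have [le_e _] := (embeddingP _ _ _).1 emb_e.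
  have [k|_ def_w] := slide_rigid le_d.
    have [_ /(_ k)] := (pleP _ _).1 le_d; have [_ /(_ k)] := (pleP _ _).1 le_e.
    rewrite !le_eqVlt => /orP[/eqP|lt_e]; first by right.
    by move=> /orP[/eqP|lt_d]; [left | case: none; exists k].
  (* The slide is between adjacent positions: [u, w] itself is a doubling. *)
  case: no_doubling; exists (strip s), c, (strip t).
  have {}def_w : w = strip s ++ c :: c :: strip t.
    by rewrite -(strip_pad w) def_w strip_block.
  have def_u : u = strip s ++ c :: strip t by rewrite -strip_d strip_block.
  rewrite -def_w -def_u; split; [|exact: word_le_refl..].
  by move: rank_uw; rewrite def_w def_u !word_rank_cat !word_rank_cons; lia.
have all_embeddings d e : embedding d u w -> embedding e u w -> C d -> C e.
  move=> emb_d emb_e; have [le_d strip_d] := (embeddingP _ _ _).1 emb_d.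
  have [le_e strip_e] := (embeddingP _ _ _).1 emb_e.
  suff : (strip d = u -> C d) -> (strip e = u -> C e).
    by move=> C_de Cd; apply: C_de.
  apply: (slide_ind (C := fun f => strip f = u -> C f)) le_d le_e _.
    move=> s c n t le_l le_r; rewrite !strip_block.
    split=> C_f strip_f; have := C_f strip_f; apply slideC; apply/embeddingP;
      by rewrite strip_block.
  by rewrite strip_d.
have open_a : open_interval u w a by rewrite -AUB; left.
have [d [k [emb_d lt_k le_a]]] := open_interval_le_lower open_a.
have open_b : open_interval u w b by rewrite -AUB; right.
have [e [l [emb_e lt_l le_b]]] := open_interval_le_lower open_b.
have open_k := lower_open emb_d lt_k (ltnW rank_uw).
have open_l := lower_open emb_e lt_l (ltnW rank_uw).
have [m lt_m K_m] : C e.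
  apply: all_embeddings emb_d emb_e _; exists k => //.
  exact/(comparable _ _ open_a open_k le_a).
apply: notAB Bb; apply/(comparable _ _ open_b open_l le_b).
exact: box_connected emb_e lt_m lt_l K_m.
Qed.

End Box.
End Boxes.

Theorem proposition7p4 (disp : Order.disp_t) (P : porderType disp)
  (forestP : rooted_forest P) (u w : seq P) (le_uw : word_le u w) :
  has_nontrivial_disconnected_subinterval u w <->
  exists (eta : seq (adjoin0 P)) (a : adjoin0 P) (i j : nat),
    [/\ embedding eta u w, (3 <= rank0 a)%N & (i < j < size w)%N] /\
    [/\ nth \bot eta i <= a <= letter w i,
        a <= letter w j
      & forall k, (i < k <= j)%N -> nth \bot eta k = \bot].
Proof.
split=> [|/contains_doublingP]; last exact: contains_doubling_disconnected.
move=> [u' [w' [[le_u _ le_w] disc rank_uw]]]; apply/contains_doublingP.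
have [x [a [y [rank_a le_u' le_w']]]] :=
  disconnected_contains_doubling forestP disc rank_uw.
exists x, a, y; split=> //; first exact: word_le_trans le_u le_u'.
exact: word_le_trans le_w' le_w.
Qed.
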